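(* Let $A$ be a simple Artinian ring and let $(P,R)$ be an invariant prime of $A$, where $R$ is a Goldie ring. For $I\in\mathcal{F}(R)$ let $v(I)=\{a\in A\mid aI\subseteq P\}$ and let $\Gamma=\{v(I)\mid I\in\mathcal{F}(R)\}$, with the operation $v(I)+v(J)=v(IJ)$. Then $\Gamma$ is a group if and only if for every fractional $R$-ideal $I$ there is a nonzero $y\in A$ with $yI\subseteq R$ but $yI\nsubseteq P$.
   Context: A prime in a ring $A$ is a pair $(P,R)$ where $R$ is a subring of $A$ and $P\subset R$ is a prime ideal of $R$ such that for all $x,y\in A$, $xRy\subseteq P$ implies $x\in P$ or $y\in P$. It is strict fractional if for every $r\neq 0$ in $A$ there are $x,y\in R$ with $0\neq xry\in R$. Put $A^{P}=\{a\in A\mid aP\subseteq P\text{ and }Pa\subseteq P\}$. A ring is Goldie if its set $S$ of regular elements satisfies the Ore condition and the localization $S^{-1}R$ is semisimple Artinian. An invariant prime of a simple Artinian ring $A$ is a strict fractional prime $(P,R)$ of $A$ with $R=A^{P}$, $R$ Goldie (so that $R$ is a prime ring and an order in $A$), and $P$ invariant under all inner automorphisms of $A$ (i.e. $uPu^{-1}\subseteq P$ for all units $u$ of $A$). A fractional $R$-ideal of $A$ is an $R$-bimodule $I\subseteq A$ which contains a regular element of $R$ and satisfies $rI\subseteq R$ for some regular $r\in R$; $\mathcal{F}(R)$ is the set of fractional $R$-ideals. The operation $+$ on $\Gamma$ is well defined with neutral element $v(R)=P$, and $\Gamma$ is totally ordered by $v(I)\leq v(J)\Leftrightarrow v(I)\subseteq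 v(J)$. *)

(* Defs.v *)
From HB Require Import structures.
From mathcomp Require Import all_boot all_algebra.
From mathcomp Require Import boolp classical_sets.

Set Implicit Arguments.
Unset Strict Implicit.
Unset Printing Implicit Defensive.
Import GRing.Theory.
Local Open Scope classical_set_scope.
Local Open Scope ring_scope.

Section RingNotions.
Variable T : nzRingType.
Implicit Types I J P : set T.

Definition left_ideal I : Prop :=
  zmod_closed (mem I) /\ forall a x, x \in I -> a * x \in I.

Definition right_ideal I : Prop :=
  zmod_closed (mem I) /\ forall a x, x \in I -> x * a \in I.

Definition ideal I : Prop := left_ideal I /\ right_ideal I.

Definition mul_set I J : set T :=
  [set x | exists n : nat, exists f g : 'I_n -> T,
     [/\ forall k, f k \in I, forall k, g k \in J &
         x = \sum_(k < n) f k * g k]].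

Definition prime_ideal P : Prop :=
  [/\ ideal P, P <> setT &
      forall I J, ideal I -> ideal J ->
        mul_set I J `<=` P -> I `<=` P \/ J `<=` P].

Definition dcc (C : set T -> Prop) : Prop :=
  forall I : nat -> set T,
    (forall n, C (I n)) -> (forall n, I n.+1 `<=` I n) ->
    exists n : nat, forall m : nat, (n <= m)%N -> I m = I n.

Definition artinian : Prop := dcc left_ideal /\ dcc right_ideal.

(* The ring is nonzero by its type. *)
Definition simple_ring : Prop :=
  forall I, ideal I -> I = [set 0] \/ I = setT.

(* The regular left module is semisimple. *)
Definition semisimple : Prop :=
  forall I, left_ideal I -> exists J, [/\ left_ideal J,
    I `&` J = [set 0] & forall x, exists2 a, a \in I & x - a \in J].

Definition regular (s : T) : Prop := GRing.lreg s /\ GRing.rreg s.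

Definition ore_condition : Prop :=
  (forall r s : T, regular s ->
     exists r' s' : T, regular s' /\ s' * r = r' * s) /\
  (forall r s : T, regular s ->
     exists r' s' : T, regular s' /\ r * s' = s * r').

End RingNotions.

(* [f : T -> Q] is the localization of [T] at its regular elements; it has
   trivial kernel because only regular elements are inverted. *)
Definition classical_quotient_ring (T : nzRingType) (Q : unitRingType)
    (f : {rmorphism T -> Q}) : Prop :=
  [/\ injective f,
      forall s, regular s -> f s \is a GRing.unit &
      forall q, exists s r : T, regular s /\ q = (f s)^-1 * f r].

Definition goldie (T : nzRingType) : Prop :=
  ore_condition T /\
  exists (Q : unitRingType) (f : {rmorphism T -> Q}),
    [/\ classical_quotient_ring f, semisimple Q & artinian Q].

(* A subring regarded as a ring in its own right. *)
Record subring_of (A : nzRingType) (R : subringClosed A) := SubringOf {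
  subring_val : A;
  _ : subring_val \in R
}.

Section SubringOf.
Variables (A : nzRingType) (R : subringClosed A).
HB.instance Definition _ := [isSub for @subring_val A R].
HB.instance Definition _ := [Choice of subring_of R by <:].
HB.instance Definition _ := [SubChoice_isSubNzRing of subring_of R by <:].
End SubringOf.

Section Primes.
Variable A : unitRingType.
Implicit Types (P I J : set A) (R : subringClosed A).

Definition prime_in P R : Prop :=
  [/\ P `<=` [set` R],
      prime_ideal [set r : subring_of R | val r \in P] &
      forall x y : A,
        (forall r, r \in R -> x * r * y \in P) -> x \in P \/ y \in P].

Definition strict_fractional R : Prop :=
  forall r : A, r != 0 ->
    exists x y : A, [/\ x \in R, y \in R, x * r * y != 0 & x * r * y \in R].

(* The ring A^P. *)
Definition idealizer P : set A :=
  [set a | forall p, p \in P -> a * p \in P /\ p * a \in P].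

Definition invariant_prime P R : Prop :=
  [/\ prime_in P R, strict_fractional R, [set` R] = idealizer P,
      goldie (subring_of R) &
      forall u p : A, u \is a GRing.unit -> p \in P -> u * p * u^-1 \in P].

Definition fractional_ideal R I : Prop :=
  [/\ zmod_closed (mem I),
      forall r x, r \in R -> x \in I -> r * x \in I /\ x * r \in I,
      exists2 r : subring_of R, regular r & val r \in I &
      exists2 r : subring_of R, regular r &
        forall x, x \in I -> val r * x \in R].

Definition val_of P I : set A := [set a | forall x, x \in I -> a * x \in P].

Definition value_set P R : set (set A) :=
  [set X | exists2 I, fractional_ideal R I & X = val_of P I].

End Primes.

Definition is_group (X : Type) (G : set X) (op : X -> X -> X) : Prop :=
  [/\ forall a b, G a -> G b -> G (op a b),
      forall a b c, G a -> G b -> G c -> op a (op b c) = op (op a b) c &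
      exists2 e, G e &
        (forall a, G a -> op e a = a /\ op a e = a) /\
        (forall a, G a -> exists2 b, G b & op b a = e /\ op a b = e)].

(* [op] is constrained only on the value set; its existence expresses that
   v(I) + v(J) = v(IJ) does not depend on the choice of I and J. *)
Definition value_set_is_group (A : unitRingType) (P : set A)
    (R : subringClosed A) : Prop :=
  exists op : set A -> set A -> set A,
    (forall I J, fractional_ideal R I -> fractional_ideal R J ->
       op (val_of P I) (val_of P J) = val_of P (mul_set I J)) /\
    is_group (value_set P R) op.

(* Main.v *)
(** If [A] had a nontrivial idempotent [e], then [R = A] and [P = 0]: for a unit
    [u] outside [R] primeness forces [u^-1] into [P], so every square-zero [n]
    lies in [R] (take [u = 1 + n]), and by simplicity the square-zero elements
    of [e A (1 - e)] and [(1 - e) A e] generate [A] as a ring.  Otherwise [A] is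
    a division ring and [P] is invariant under every nonzero element.  In both
    cases [x I <= P] iff [I x <= P] for a fractional ideal [I], which makes
    [v(I) + v(J) = v(IJ)] well defined.  If [yI <= R] and [yI] is not in [P],
    then by primeness [v(Ry)] is inverse to [v(I)]; conversely, if [v(J)] is
    inverse to [v(I)], then any [y] in [J] with [yI] not in [P] works. *)
Require Import Defs.
From HB Require Import structures.
From mathcomp Require Import all_boot all_algebra.
From mathcomp Require Import boolp classical_sets.
Set Implicit Arguments.
Unset Strict Implicit.
Unset Printing Implicit Defensive.
Import GRing.Theory.
Local Open Scope classical_set_scope.
Local Open Scope ring_scope.

(** * Additive subgroups and products of subsets *)

Section AdditiveSubgroups.
Variable T : zmodType.
Implicit Types (I : set T) (x y : T).

Lemma zmod_closed_opp I x : zmod_closed (mem I) -> x \in I -> - x \in I.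
Proof. by case=> I0 IB Ix; rewrite -[- x]sub0r; apply: IB. Qed.

Lemma zmod_closed_add I x y :
  zmod_closed (mem I) -> x \in I -> y \in I -> x + y \in I.
Proof.
move=> zI Ix Iy; rewrite -[y]opprK.
by case: (zI) => _; apply=> //; apply: zmod_closed_opp.
Qed.

Lemma zmod_closed_sum I n (f : 'I_n -> T) :
  zmod_closed (mem I) -> (forall k, f k \in I) -> \sum_(k < n) f k \in I.
Proof.
move=> zI If; elim/big_ind: _ => //; first by case: zI.
by move=> x y; apply: zmod_closed_add.
Qed.

End AdditiveSubgroups.

Section Products.
Variable T : nzRingType.
Implicit Types (I J : set T) (x y : T).

Lemma mul_setM I J x y : x \in I -> y \in J -> x * y \in mul_set I J.
Proof.
move=> Ix Jy; rewrite in_setE; exists 1%N, (fun=> x), (fun=> y).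
by split=> //; rewrite big_ord1.
Qed.

Lemma mul_set_zmod I J : zmod_closed (mem I) -> zmod_closed (mem (mul_set I J)).
Proof.
move=> zI; split.
  rewrite in_setE; exists 0%N, (fun=> 0), (fun=> 0).
  by split; [case | case | rewrite big_ord0].
move=> x y; rewrite !in_setE => -[n [f [g [If Jg ->]]]] [m [f' [g' [If' Jg' ->]]]].
exists (n + m)%N.
exists (fun k => match split k with inl i => f i | inr i => - f' i end).
exists (fun k => match split k with inl i => g i | inr i => g' i end).
split.
- by move=> k; case: (split k) => // i; apply: zmod_closed_opp.
- by move=> k; case: (split k).
rewrite big_split_ord /=; congr (_ + _).
  by apply: eq_bigr => i _; rewrite (unsplitK (inl i)).
rewrite -sumrN; apply: eq_bigr => i _.
by rewrite (unsplitK (inr i)) mulNr.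
Qed.

Lemma mul_set_min I J (D : set T) : zmod_closed (mem D) ->
    (forall x y, x \in I -> y \in J -> x * y \in D) ->
  forall z, z \in mul_set I J -> z \in D.
Proof.
move=> zD IJD z; rewrite in_setE => -[n [f [g [If Jg ->]]]].
by apply: zmod_closed_sum => // k; apply: IJD.
Qed.

End Products.

(** * Minimal left ideals and idempotents in simple rings *)

Section SimpleRings.
Variable A : unitRingType.
Hypothesis simpleA : simple_ring A.

Lemma simple_ideal_full (K : set A) z :
  ideal K -> z \in K -> z != 0 -> forall x, x \in K.
Proof.
move=> idK Kz z0 x; case: (simpleA idK) => KE; rewrite KE in Kz *; last by rewrite inE.
by move: Kz z0; rewrite in_setE /= => ->; rewrite eqxx.
Qed.

(** Without a minimal one, every nonzero left ideal strictly contains another, and iterating from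
    [setT] contradicts the chain condition. *)
Lemma artinian_minimal_left_ideal : artinian A ->
  exists L : set A, [/\ left_ideal L, exists2 x, x \in L & x != 0 &
    forall M : set A, left_ideal M -> (exists2 x, x \in M & x != 0) ->
      M `<=` L -> M = L].
Proof.
case=> dccA _; apply: contrapT => noL.
pose nz (M : set A) := left_ideal M /\ exists2 x, x \in M & x != 0.
(* Putting [nz L] under the existential makes the statement total, so that [choice] yields a
   function on all sets. *)
have step (L : set A) : exists M, nz L -> [/\ nz M, M `<=` L & M <> L].
  case: (pselect (nz L)) => [[lL nL]|nL]; last by exists L.
  apply: contrapT => noM; apply: noL; exists L; split=> // M lM nM ML.
  by apply: contrapT => neq; apply: noM; exists M.
have [F FP] := choice step.
pose I n := iter n F setT.
have nzI n : nz (I n).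
  elim: n => [|n IHn]; last by case: (FP _ IHn).
  split; last by exists 1; rewrite ?inE ?oner_neq0.
  by split; [split=> [|x y _ _]|move=> x y _]; rewrite in_setE.
have [||n In] := dccA I; first by move=> n; case: (nzI n).
  by move=> n; case: (FP _ (nzI n)).
by case: (FP _ (nzI n)) => _ _; apply; apply: (In n.+1).
Qed.

(** Brauer's argument: a minimal left ideal [L] with nonzero square contains a nonzero idempotent
    [e]. If [e = 1], then [L] is all of [A], and minimality makes every nonzero element left
    invertible. *)
Lemma division_or_idempotent : artinian A ->
  (forall x : A, x != 0 -> x \is a GRing.unit) \/
  (exists e : A, [/\ e * e = e, e != 0 & 1 - e != 0]).
Proof.
move=> artA; have [L [lL [l0 Ll0 l0n0] minL]] := artinian_minimal_left_ideal artA.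
have [zL LM] := lL.
have [x Lx [l Ll lx0]] : exists2 x, x \in L & exists2 l, l \in L & l * x != 0.
  apply: contrapT => LL0.
  (* If [L] had square zero, this two-sided ideal would contain [l0], hence [1], forcing
     [l0 = 0]. *)
  pose K := [set z : A | forall l a, l \in L -> l * a * z = 0].
  have idK : ideal K.
    split; split.
    - split; rewrite ?in_setE; first by move=> l a _; rewrite mulr0.
      move=> y z; rewrite !in_setE => Ky Kz l a Ll.
      by rewrite mulrBr Ky ?Kz ?subr0.
    - move=> b y; rewrite !in_setE => Ky l a Ll.
      by rewrite mulrA -(mulrA l) Ky.
    - split; rewrite ?in_setE; first by move=> l a _; rewrite mulr0.
      move=> y z; rewrite !in_setE => Ky Kz l a Ll.
      by rewrite mulrBr Ky ?Kz ?subr0.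
    - move=> b y; rewrite !in_setE => Ky l a Ll.
      by rewrite mulrA Ky ?mul0r.
  have Kl0 : l0 \in K.
    rewrite in_setE => l a Ll; apply/eqP; apply: contrapT => /negP nz.
    by apply: LL0; exists (a * l0); [apply: LM | exists l => //; rewrite mulrA].
  have := simple_ideal_full idK Kl0 l0n0 1.
  rewrite in_setE => /(_ l0 1 Ll0); rewrite !mulr1 => l0E.
  by rewrite l0E eqxx in l0n0.
have Lx_eq : [set z | exists2 l, l \in L & z = l * x] = L.
  apply: minL.
  - split.
      split; rewrite ?in_setE; first by exists 0; rewrite ?mul0r //; case: zL.
      move=> y z; rewrite !in_setE => -[u Lu ->] [w Lw ->].
      by exists (u - w); rewrite ?mulrBl //; case: zL => _; apply.
    move=> a y; rewrite !in_setE => -[u Lu ->].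
    by exists (a * u); rewrite ?mulrA //; apply: LM.
  - by exists (l * x); rewrite // in_setE; exists l.
  - by move=> z [u Lu ->]; rewrite -in_setE; apply: LM.
(* The annihilator of [x] in [L] is a left ideal missing [l], so minimality makes it zero. *)
have annL0 : forall z, z \in L -> z * x = 0 -> z = 0.
  move=> z Lz zx0; apply/eqP; apply: contrapT => /negP zn0.
  have annE : [set z | z \in L /\ z * x = 0] = L.
    apply: minL.
    - split.
        split; rewrite ?in_setE; first by rewrite /= mul0r; case: zL.
        move=> y t; rewrite !in_setE => -[Ly y0] [Lt t0]; split.
          by case: zL => _; apply.
        by rewrite mulrBl y0 t0 subr0.
      move=> a y; rewrite !in_setE => -[Ly y0]; split; first exact: LM.
      by rewrite -mulrA y0 mulr0.
    - by exists z => //; rewrite in_setE.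
    - by move=> y [Ly _]; rewrite -in_setE.
  by move: Ll; rewrite -annE in_setE => -[_ lx]; rewrite lx eqxx in lx0.
have xn0 : x != 0 by apply: contraNneq lx0 => ->; rewrite mulr0.
have [e Le xe] : exists2 e, e \in L & x = e * x.
  by move: Lx; rewrite -{1}Lx_eq in_setE.
(* [e * e - e] lies in [L] and annihilates [x]. *)
have ee : e * e = e.
  apply/eqP; rewrite -subr_eq0; apply/eqP; apply: annL0.
    by case: zL => _; apply=> //; apply: LM.
  by rewrite mulrBl -mulrA -!xe subrr.
have en0 : e != 0 by apply: contraNneq xn0 => e0; rewrite xe e0 mul0r.
case: (eqVneq (1 - e) 0) => [e1|]; last by right; exists e.
left; have {}e1 : e = 1 by apply/esym/eqP; rewrite -subr_eq0 e1.
have Linv (y : A) : y != 0 -> exists z, z * y = 1.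
  move=> yn0.
  have AyE : [set z | exists a, z = a * y] = L.
    apply: minL.
    - split.
        split; rewrite ?in_setE; first by exists 0; rewrite mul0r.
        move=> s t; rewrite !in_setE => -[u ->] [w ->].
        by exists (u - w); rewrite mulrBl.
      by move=> a s; rewrite !in_setE => -[u ->]; exists (a * u); rewrite mulrA.
    - by exists y; rewrite // in_setE; exists 1; rewrite mul1r.
    - by move=> z _; rewrite -in_setE -[z]mulr1 -e1; apply: LM.
  by move: Le; rewrite e1 -AyE in_setE => -[a aE]; exists a.
move=> y yn0; apply/unitrP; have [z zy] := Linv _ yn0.
have [w wz] : exists w, w * z = 1.
  by apply: Linv; apply: contra_eq_neq zy => ->; rewrite mul0r eq_sym oner_neq0.
by exists z; split=> //; rewrite -[y]mul1r -{1}wz -(mulrA w) zy mulr1.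
Qed.

(* The ideal of all [z] with [e A z A e] inside [R] contains [1 - e]. *)
Lemma corner_sub (R : subringClosed A) e :
    (forall n : A, n * n = 0 -> n \in R) -> e * e = e -> 1 - e != 0 ->
  forall a, e * a * e \in R.
Proof.
move=> sq0 ee f0 a.
have ef : e * (1 - e) = 0 by rewrite mulrBr mulr1 ee subrr.
have fe : (1 - e) * e = 0 by rewrite mulrBl mul1r ee subrr.
have ff : (1 - e) * (1 - e) = 1 - e by rewrite mulrBr mulr1 fe subr0.
pose K := [set z | forall a b, e * a * z * b * e \in R].
have zK : zmod_closed (mem K).
  split; rewrite ?in_setE; first by move=> b c; rewrite mulr0 !mul0r rpred0.
  move=> y z; rewrite !in_setE => Ky Kz b c.
  by rewrite mulrBr !mulrBl rpredB.
have idK : ideal K.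
  split; split=> // c y; rewrite !in_setE => Ky b d.
    by rewrite (mulrA _ c y) -(mulrA e b c) Ky.
  by rewrite (mulrA _ y c) -(mulrA _ c d) Ky.
have Kf : 1 - e \in K.
  rewrite in_setE => b c.
  have -> : e * b * (1 - e) * c * e = (e * b * (1 - e)) * ((1 - e) * c * e).
    by rewrite -!mulrA (mulrA (1 - e) (1 - e)) ff.
  rewrite rpredM // sq0 //.
    by rewrite -(mulrA _ (1 - e)) !(mulrA (1 - e)) fe !mul0r mulr0.
  by rewrite -(mulrA _ e) !(mulrA e) ef !mul0r mulr0.
have := simple_ideal_full idK Kf f0 1.
by rewrite in_setE => /(_ a 1); rewrite !mulr1.
Qed.

End SimpleRings.

(** * Invariant primes: conjugation, units and the dichotomy *)

Section InvariantPrimes.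
Variables (A : unitRingType) (P : set A) (R : subringClosed A).
Hypotheses (simpleA : simple_ring A) (artA : artinian A).
Hypothesis invP : invariant_prime P R.

Implicit Types (I J : set A).

Lemma prime_subR p : p \in P -> p \in R.
Proof. by case: invP => -[PR _ _] _ _ _ _ Pp; apply/PR; rewrite -in_setE. Qed.

Lemma memR_idealizer a :
  (a \in R) <-> (forall p, p \in P -> a * p \in P /\ p * a \in P).
Proof.
case: invP => _ _ RE _ _.
by split=> [Ra | Ha]; [have : [set` R] a by [] | have : idealizer P a by []];
  rewrite ?RE // -RE.
Qed.

Lemma prime_mulr p r : p \in P -> r \in R -> p * r \in P.
Proof. by move=> Pp /memR_idealizer /(_ p Pp) []. Qed.

Lemma prime_mull p r : p \in P -> r \in R -> r * p \in P.
Proof. by move=> Pp /memR_idealizer /(_ p Pp) []. Qed.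

(** [prime_in] speaks of the preimage of [P] in [subring_of R]; closure transfers to [A] because [P]
    lies in [R]. *)
Lemma prime_zmod : zmod_closed (mem P).
Proof.
case: invP => -[_ [[[[P0 PB] _] _] _ _] _] _ _ _ _.
split.
  by move: P0; rewrite in_setE -[0 in X in _ -> X](raddf0 (val : subring_of R -> A)).
move=> x y Px Py.
have Qx : SubringOf (prime_subR Px) \in [set r : subring_of R | val r \in P].
  by rewrite in_setE.
have Qy : SubringOf (prime_subR Py) \in [set r : subring_of R | val r \in P].
  by rewrite in_setE.
by have := PB _ _ Qx Qy; rewrite in_setE.
Qed.

Lemma prime_not1 : 1 \notin P.
Proof.
apply/negP => P1; case: invP => -[_ [_ PT _] _] _ _ _ _.
apply: PT; apply/seteqP; split=> // x _ /=.
by rewrite -[val x]mul1r; apply: prime_mulr => //; apply: valP.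
Qed.

Lemma primeP x y :
  (forall r, r \in R -> x * r * y \in P) -> x \in P \/ y \in P.
Proof. by case: invP => -[_ _ +] _ _ _ _; apply. Qed.

Lemma prime_conj u p : u \is a GRing.unit -> p \in P -> u * p * u^-1 \in P.
Proof. by case: invP => _ _ _ _; apply. Qed.

(** [R] is the idealizer of [P], so it inherits invariance under conjugation. *)
Lemma memR_conj u r : u \is a GRing.unit -> r \in R -> u * r * u^-1 \in R.
Proof.
move=> uu Rr; apply/memR_idealizer => p Pp.
have Pp' : u^-1 * p * u \in P by rewrite -{2}[u]invrK prime_conj ?unitrV.
split.
  have -> : u * r * u^-1 * p = u * (r * (u^-1 * p * u)) * u^-1.
    by rewrite !mulrA mulrK.
  by apply: prime_conj => //; apply: prime_mull.
have -> : p * (u * r * u^-1) = u * (u^-1 * p * u * r) * u^-1.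
  by rewrite !mulrA divrr ?mul1r.
by apply: prime_conj => //; apply: prime_mulr.
Qed.

Lemma unit_memR_or_invP u : u \is a GRing.unit -> u \in R \/ u^-1 \in P.
Proof.
move=> uu; case: (pselect (u^-1 \in P)) => [|nP]; [by right | left].
have PuP p : p \in P -> u * p \in P.
  (* Primeness applies since [u^-1 * r * u] is in [R], which puts [u^-1 * r * u * p] in [P]. *)
  move=> Pp; case: (@primeP u^-1 (u * p)) => // r Rr.
  rewrite mulrA -{2}[u]invrK.
  by apply: prime_mull => //; apply: memR_conj; rewrite ?unitrV.
apply/memR_idealizer => p Pp; split; first exact: PuP.
have -> : p * u = u * (u^-1 * p * u) by rewrite !mulrA divrr ?mul1r.
by apply: PuP; rewrite -{2}[u]invrK prime_conj ?unitrV.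
Qed.

Lemma square_zero_memR n : n * n = 0 -> n \in R.
Proof.
move=> nn.
have inv1 : (1 + n) * (1 - n) = 1.
  by rewrite mulrDl mul1r mulrBr mulr1 nn subr0 subrK.
have inv2 : (1 - n) * (1 + n) = 1.
  by rewrite mulrBl mul1r mulrDr mulr1 nn addr0 addrK.
have u1 : 1 + n \is a GRing.unit by apply/unitrP; exists (1 - n).
have [R1|P1] := unit_memR_or_invP u1.
  by rewrite -(addKr 1 n) addrC rpredB ?rpred1.
have E : (1 + n)^-1 = 1 - n by apply: (mulrI u1); rewrite inv1 divrr.
move: P1; rewrite E => /prime_subR R1.
by rewrite -(subKr 1 n) rpredB ?rpred1.
Qed.

Lemma division_or_trivial :
  (forall x : A, x != 0 -> x \is a GRing.unit) \/
  ((forall x, x \in R) /\ (forall x, x \in P -> x = 0)).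
Proof.
have [|[e [ee e0 f0]]] := division_or_idempotent simpleA artA; [by left | right].
have ef : e * (1 - e) = 0 by rewrite mulrBr mulr1 ee subrr.
have fe : (1 - e) * e = 0 by rewrite mulrBl mul1r ee subrr.
have ff : (1 - e) * (1 - e) = 1 - e by rewrite mulrBr mulr1 fe subr0.
have RT x : x \in R.
  (* Peirce decomposition: [corner_sub] for [e] and for [1 - e] handles the diagonal terms, and the
     off-diagonal ones square to zero. *)
  have -> : x = e * x * e + e * x * (1 - e)
                + ((1 - e) * x * e + (1 - e) * x * (1 - e)).
    by rewrite -!mulrDr !subrKC !mulr1 -mulrDl subrKC mul1r.
  have Rc := corner_sub simpleA square_zero_memR.
  rewrite !rpredD //.
  - exact: Rc.
  - apply: square_zero_memR.
    by rewrite -(mulrA _ (1 - e)) !(mulrA (1 - e)) fe !mul0r mulr0.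
  - by apply: square_zero_memR; rewrite -(mulrA _ e) !(mulrA e) ef !mul0r mulr0.
  - by apply: Rc => //; rewrite subKr.
split=> // x Px; apply/eqP; apply: contrapT => /negP xn0.
(* Once [R] is all of [A], [P] is a two-sided ideal of [A] that omits [1], hence zero by
   simplicity. *)
have idP : ideal P.
  split; split; try exact: prime_zmod; move=> a y Py.
    exact: prime_mull.
  exact: prime_mulr.
by have := simple_ideal_full simpleA idP Px xn0 1; rewrite (negPf prime_not1).
Qed.

(** * Regular elements and commutation modulo [P] *)

Lemma regular_neq0 (r : subring_of R) : regular r -> val r != 0.
Proof.
case=> rl _; apply: contraTneq isT => r0.
have rE : r = 0 by apply: val_inj; rewrite r0 raddf0.
have /eqP : (1 : subring_of R) = 0 by apply: rl; rewrite rE !mul0r.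
by rewrite oner_eq0.
Qed.

Lemma regular_division (r : subring_of R) :
  (forall x : A, x != 0 -> x \is a GRing.unit) -> val r != 0 -> regular r.
Proof.
move=> divA /divA ur.
by split=> x y /(congr1 val); rewrite !rmorphM => E; apply: val_inj;
  [apply: (mulrI ur) | apply: (mulIr ur)].
Qed.

Lemma fractional_trivial I :
  (forall x, x \in R) -> fractional_ideal R I -> forall x, x \in I.
Proof.
move=> RT [zI IR [r regr Ir] _].
apply: (simple_ideal_full simpleA _ Ir (regular_neq0 regr)).
by split; split=> // a x Ix; case: (IR a x).
Qed.

(** Conjugation by [y] turns [x * y] into [y * x]. *)
Lemma prime_comm_division x y :
  (forall x : A, x != 0 -> x \is a GRing.unit) -> x * y \in P -> y * x \in P.
Proof.
move=> divA; case: (eqVneq y 0) => [->|/divA uy]; first by rewrite mulr0 mul0r.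
by move=> /(prime_conj uy); rewrite -!mulrA divrr ?mulr1.
Qed.

Lemma val_of_comm I x : fractional_ideal R I ->
  (forall i, i \in I -> x * i \in P) <-> (forall i, i \in I -> i * x \in P).
Proof.
move=> fI; case: division_or_trivial => [divA|[RT P0]].
  by split=> H i Ii; apply: prime_comm_division (H i Ii).
(* Here [1] is in [I] and [P] is zero, so either condition forces [x = 0]. *)
have IT := fractional_trivial RT fI.
split=> H i _; have /P0 := H 1 (IT 1); rewrite ?mulr1 ?mul1r => ->;
  rewrite ?mulr0 ?mul0r; by case: prime_zmod.
Qed.

(** For a unit [z] the missing side follows from [z * p = (z * p * z^-1) * z] and invariance of
    [P]. *)
Lemma right_idealizer_memR z : (forall p, p \in P -> p * z \in P) -> z \in R.
Proof.
move=> Pz; case: division_or_trivial => [divA|[RT _]]; last exact: RT.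
case: (eqVneq z 0) => [->|/divA uz]; first exact: rpred0.
apply/memR_idealizer => p Pp; split; last exact: Pz.
by rewrite -[z * p](mulrVK uz); apply: Pz; apply: prime_conj.
Qed.

(** * Values and products of fractional ideals *)

Lemma fractional_R : fractional_ideal R [set` R].
Proof.
have in1 x : (x \in [set` R]) = (x \in R) by apply/idP/idP; rewrite in_setE.
have reg1 : regular (1 : subring_of R).
  by split=> x y; rewrite ?mul1r ?mulr1.
split.
- split; first by rewrite in1 rpred0.
  by move=> x y; rewrite !in1; apply: rpredB.
- by move=> r x Rr; rewrite !in1 => Rx; rewrite !rpredM.
- by exists 1; rewrite // in1 rmorph1 rpred1.
- by exists 1 => // x; rewrite in1 rmorph1 mul1r.
Qed.

(** [P] is closed under sums, so testing the generators [i * j] suffices. *)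
Lemma val_mulP I J a :
  val_of P (mul_set I J) a <->
  (forall i j, i \in I -> j \in J -> a * i * j \in P).
Proof.
split=> [va i j Ii Jj | aIJ z].
  by rewrite -mulrA; apply: va; apply: mul_setM.
move=> IJz; have : z \in [set z | a * z \in P].
  apply: (mul_set_min _ _ IJz) => [|x y Ix Jy].
    have [P0 PB] := prime_zmod.
    split=> [|x y]; first by rewrite in_setE /= mulr0.
    rewrite !in_setE /= => Px Py; rewrite /= mulrBr; exact: PB.
  by rewrite in_setE /= mulrA aIJ.
by rewrite in_setE.
Qed.

Lemma val_of_R : val_of P [set` R] = P.
Proof.
apply/seteqP; split=> a; rewrite /val_of /=.
  by move=> /(_ 1); rewrite mulr1 !in_setE; apply; apply: rpred1.
by move=> Pa x; rewrite in_setE => Rx; apply: prime_mulr; rewrite // in_setE.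
Qed.

Lemma val_mulR I : fractional_ideal R I -> val_of P (mul_set I [set` R]) = val_of P I.
Proof.
case=> _ IR _ _; apply/seteqP; split=> a.
  move/val_mulP => H i Ii; rewrite -[a * i]mulr1; apply: H => //.
  by rewrite in_setE; apply: rpred1.
move=> H; apply/val_mulP => i r Ii; rewrite in_setE => Rr.
by rewrite -mulrA; apply: H; case: (IR r i).
Qed.

Lemma val_Rmul I : fractional_ideal R I -> val_of P (mul_set [set` R] I) = val_of P I.
Proof.
case=> _ IR _ _; apply/seteqP; split=> a.
  move/val_mulP => H i Ii; rewrite -[a]mulr1; apply: H => //.
  by rewrite in_setE; apply: rpred1.
move=> H; apply/val_mulP => r i; rewrite in_setE => Rr Ii.
by rewrite -mulrA; apply: H; case: (IR r i).
Qed.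

Lemma val_mulA I J K : val_of P (mul_set I (mul_set J K)) =
  val_of P (mul_set (mul_set I J) K).
Proof.
apply/seteqP; split=> a /val_mulP H; apply/val_mulP.
  move=> z k IJz Kk; suff : z \in [set z | a * z * k \in P] by rewrite in_setE.
  apply: (mul_set_min _ _ IJz) => [|i j Ii Jj].
    have [P0 PB] := prime_zmod.
    split=> [|x y]; first by rewrite in_setE /= mulr0 mul0r.
    by rewrite !in_setE /= => Px Py; rewrite /= mulrBr mulrBl; apply: PB.
  by rewrite in_setE /= mulrA -mulrA; apply: H => //; apply: mul_setM.
move=> i z Ii; apply: (proj2 (@val_mulP J K (a * i))) => j k Jj Kk.
by rewrite -(mulrA a); apply: H => //; apply: mul_setM.
Qed.

Lemma fractional_mul I J :
  fractional_ideal R I -> fractional_ideal R J -> fractional_ideal R (mul_set I J).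
Proof.
move=> [zI IR [r regr Ir] [s regs sI]] [zJ JR [r' regr' Jr'] [s' regs' sJ]].
have regM (x y : subring_of R) : regular x -> regular y -> regular (x * y).
  by move=> [xl xr] [yl yr]; split; [apply: lregM | apply: rregM].
have zIJ := mul_set_zmod J zI.
split=> //.
- move=> t z Rt IJz; split.
    suff : z \in [set z | t * z \in mul_set I J] by rewrite in_setE.
    apply: (mul_set_min _ _ IJz) => [|i j Ii Jj].
      case: zIJ => z0 zB.
      split=> [|x y]; first by rewrite in_setE /= mulr0.
      by rewrite !in_setE /= => Px Py; rewrite /= mulrBr; apply: zB.
    by rewrite in_setE /= mulrA; apply: mul_setM => //; case: (IR t i).
  suff : z \in [set z | z * t \in mul_set I J] by rewrite in_setE.
  apply: (mul_set_min _ _ IJz) => [|i j Ii Jj].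
    case: zIJ => z0 zB.
    split=> [|x y]; first by rewrite in_setE /= mul0r.
    by rewrite !in_setE /= => Px Py; rewrite /= mulrBl; apply: zB.
  by rewrite in_setE /= -mulrA; apply: mul_setM => //; case: (JR t j).
- by exists (r * r'); [apply: regM | rewrite rmorphM; apply: mul_setM].
(* [s * i] lies in [R], so [s * i * j] stays in [J] and [s'] brings it into [R]. *)
- exists (s' * s); first exact: regM.
  move=> z IJz; suff : z \in [set z | val s' * val s * z \in R].
    by rewrite in_setE rmorphM.
  apply: (mul_set_min _ _ IJz) => [|i j Ii Jj].
    split=> [|x y]; first by rewrite in_setE /= mulr0 rpred0.
    by rewrite !in_setE /= => Px Py; rewrite /= mulrBr rpredB.
  rewrite in_setE /= -mulrA (mulrA (val s)); apply: sJ.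
  by case: (JR (val s * i) j); first exact: sI.
Qed.

(** [val_of_comm] moves the factor from [J] to the far left, which exposes [I] on the right for
    replacement by [I']; moving it back allows [J] to be replaced by [J']. *)
Lemma val_mul_eq I I' J J' :
    fractional_ideal R I -> fractional_ideal R I' -> fractional_ideal R J ->
    val_of P I = val_of P I' -> val_of P J = val_of P J' ->
  val_of P (mul_set I J) `<=` val_of P (mul_set I' J').
Proof.
move=> fI fI' fJ EI EJ a /val_mulP aIJ; apply/val_mulP => i j Ii Jj.
have : val_of P J (a * i).
  apply/(val_of_comm _ fJ) => k Jk.
  have : val_of P I (k * a).
    move=> l Il; rewrite -mulrA.
    by apply: (proj1 (val_of_comm (a * l) fJ)) Jk => m Jm; apply: aIJ.
  by rewrite EI mulrA => /(_ i Ii).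
by rewrite EJ => /(_ j Jj).
Qed.

(** The inverse is the value of [J = R y], which is a bimodule because
    [y * r = (y * r * y^-1) * y]. *)
Lemma val_inverse_division I y :
    (forall x : A, x != 0 -> x \is a GRing.unit) -> fractional_ideal R I ->
    y != 0 -> (forall x, x \in I -> y * x \in R) ->
    ~ (forall x, x \in I -> y * x \in P) ->
  exists J, [/\ fractional_ideal R J, val_of P (mul_set J I) = P
    & val_of P (mul_set I J) = P].
Proof.
move=> divA [zI IR [s regs Is] _] yn0 yIR yIP.
have uy := divA _ yn0; have sn0 := regular_neq0 regs.
have us := divA _ sn0.
have Rconj z : z \in R -> y^-1 * z * y \in R.
  by move=> Rz; rewrite -{2}[y]invrK memR_conj ?unitrV.
have Rys : y * val s \in R by apply: yIR.
(* [s * y] is the conjugate of [y * s] by [y^-1]; it will serve as the regular element of [R]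
   contained in [J]. *)
have Rsy : val s * y \in R by have := Rconj _ Rys; rewrite mulKr.
have [x Ix yx] : exists2 x, x \in I & y * x \notin P.
  apply: contrapT => nx; apply: yIP => x Ix; apply: contrapT => /negP yx.
  by apply: nx; exists x.
pose J := [set z | exists2 r, r \in R & z = r * y].
have fJ : fractional_ideal R J.
  split.
  - split; first by rewrite in_setE; exists 0; rewrite ?rpred0 ?mul0r.
    move=> a b; rewrite !in_setE => -[r Rr ->] [r' Rr' ->].
    by exists (r - r'); rewrite ?rpredB ?mulrBl.
  - move=> r z Rr; rewrite !in_setE => -[t Rt ->]; split.
      by exists (r * t); rewrite ?rpredM ?mulrA.
    exists (t * (y * r * y^-1)); first by rewrite rpredM ?memR_conj.
    by rewrite !mulrA mulrVK.
  - exists (SubringOf Rsy).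
      apply: regular_division => //=; apply: contraNneq yn0 => sy0.
      by rewrite -[y](mulKr us) sy0 mulr0.
    by rewrite in_setE /=; exists (val s) => //; apply: valP.
  - exists s => // z; rewrite in_setE => -[r Rr ->].
    have -> : val s * (r * y) = val s * r * (val s)^-1 * (val s * y).
      by rewrite !mulrA mulrVK.
    by rewrite rpredM ?memR_conj.
exists J; split=> //; apply/seteqP; split=> a.
- move/val_mulP => H; rewrite -in_setE.
  (* Primeness is applied to [a] and [y * x], bracketing [a * r * (y * x)] as [a * (r * y) * x] with
     [r * y] in [J]. *)
  have [//|] : a \in P \/ y * x \in P; last by rewrite (negPf yx).
  apply: primeP => r Rr; rewrite mulrA -(mulrA a); apply: H => //.
  by rewrite in_setE; exists r.
- rewrite -in_setE => Pa; apply/val_mulP => j i; rewrite in_setE => -[r Rr ->] Ii.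
  by rewrite -!mulrA prime_mulr // rpredM ?yIR.
- move/val_mulP => H; rewrite -in_setE.
  have [//|] : a \in P \/ x * y \in P; last first.
    by move/(prime_comm_division divA); rewrite (negPf yx).
  apply: primeP => r Rr; rewrite mulrA -(mulrA a); apply: H => //.
    by case: (IR r x).
  by rewrite in_setE; exists 1; rewrite ?rpred1 ?mul1r.
- rewrite -in_setE => Pa; apply/val_mulP => i j Ii; rewrite in_setE => -[r Rr ->].
  (* Moving [y] to the front leaves [y * a * y^-1], in [P], times [y * (i * r)], in [R]. *)
  rewrite mulrA -(mulrA a); apply: prime_comm_division => //.
  have -> : y * (a * (i * r)) = y * a * y^-1 * (y * (i * r)).
    by rewrite !mulrA mulrVK.
  by rewrite prime_mulr ?prime_conj // yIR; case: (IR r i).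
Qed.

(** Intersecting over all representatives avoids choosing any; [val_mul_eq] shows that the
    intersected sets coincide. *)
Definition value_add (X Y : set A) : set A :=
  [set a | forall I J, fractional_ideal R I -> fractional_ideal R J ->
    X = val_of P I -> Y = val_of P J -> val_of P (mul_set I J) a].

Lemma value_addE I J : fractional_ideal R I -> fractional_ideal R J ->
  value_add (val_of P I) (val_of P J) = val_of P (mul_set I J).
Proof.
move=> fI fJ; apply/seteqP; split=> a; first by apply.
by move=> H I' J' fI' fJ' EI EJ; apply: val_mul_eq H.
Qed.

End InvariantPrimes.

Theorem proposition3p2 (A : unitRingType) (P : set A) (R : subringClosed A) :
  simple_ring A -> artinian A -> invariant_prime P R ->
  value_set_is_group P R <->
  (forall I : set A, fractional_ideal R I ->
     exists y : A, [/\ y != 0,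
       forall x, x \in I -> y * x \in R &
       ~ (forall x, x \in I -> y * x \in P)]).
Proof.
move=> simpleA artA invP; have fR := fractional_R R; split.
  move=> [op [opE [_ _ [_ [E fE ->] [unitE invE]]]]] I fI.
  (* The abstract neutral element is identified by adding [v(R) = P] to it:
     [v(E) = v(E R) = v(E) + v(R) = v(R)]. *)
  have EP : val_of P E = P.
    rewrite -(val_mulR invP fE) -opE //.
    have -> : op (val_of P E) (val_of P [set` R]) = val_of P [set` R].
      by apply: (unitE _ _).1; exists [set` R].
    exact: val_of_R.
  have [|_ [J fJ ->] []] := invE (val_of P I); first by exists I.
  rewrite !opE // EP => JIP _.
  (* Otherwise [1] would belong to [v(JI) = P]. *)
  have [y Jy [x Ix yx]] : exists2 y, y \in J & exists2 x, x \in I & y * x \notin P.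
    apply: contrapT => nyx.
    have /negP := prime_not1 invP; apply; rewrite -JIP in_setE.
    apply/(val_mulP invP) => j i Jj Ii; rewrite mul1r.
    apply: contrapT => /negP ji; apply: nyx; by exists j => //; exists i.
  exists y; split.
  - by apply: contraNneq yx => ->; rewrite mul0r; case: (prime_zmod invP).
  (* [P = v(JI)] gives only the right-hand condition, that [p * (y * i)] is in [P]. *)
  - move=> i Ii; apply: (right_idealizer_memR simpleA artA invP) => p Pp.
    have /(val_mulP invP) pJI : val_of P (mul_set J I) p by rewrite JIP -in_setE.
    by rewrite mulrA pJI.
  - by move=> H; rewrite H in yx.
move=> yI; exists (value_add P R).
have addE := value_addE simpleA artA invP.
split; first exact: addE.
split.
- move=> _ _ [I fI ->] [J fJ ->]; rewrite addE //.
  by exists (mul_set I J) => //; apply: fractional_mul.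
- move=> _ _ _ [I fI ->] [J fJ ->] [K fK ->].
  have fIJ := fractional_mul fI fJ; have fJK := fractional_mul fJ fK.
  by rewrite !addE // (val_mulA invP).
exists (val_of P [set` R]); first by exists [set` R].
split.
  by move=> _ [I fI ->]; rewrite !addE // (val_mulR invP) ?(val_Rmul invP).
move=> _ [I fI ->].
have [divA|[RT P0]] := division_or_trivial simpleA artA invP.
  have [y [yn0 yIR yIP]] := yI _ fI.
  have [J [fJ JI IJ]] := val_inverse_division invP divA fI yn0 yIR yIP.
  exists (val_of P J); first by exists J.
  by rewrite !addE // (val_of_R invP).
(* When [R] is all of [A], the only fractional ideal is [R], so the group is trivial. *)
have -> : I = [set` R].
  apply/seteqP; split=> x _; first exact: RT.
  by rewrite -in_setE; apply: (fractional_trivial simpleA RT).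
exists (val_of P [set` R]); first by exists [set` R].
by rewrite !addE // (val_mulR invP).
Qed.
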